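(* Let $b\ge 2$ be an integer and let $w$ be a fixed block of $b$-ary digits of length $p\ge1$. For each integer $k\ge 0$ let $\mu_k$ be the discrete measure on $[0,1)$ $$\mu_k=\sum_{X:\,k_w(X)=k} b^{-|X|}\,\delta_{x(X)},$$ where the sum is over all finite strings $X$ of $b$-ary digits (the empty string included) with $k_w(X)=k$. Then, as $k\to\infty$, $\mu_k$ converges weakly to $b^p$ times Lebesgue measure on $[0,1)$. Precisely, for every interval $I\subset[0,1)$, $$\lim_{k\to\infty}\mu_k(I)=b^p\,|I|,$$ where $|I|=\sup I-\inf I$.
   Context: Strings are finite sequences over the alphabet $\{0,1,\dots,b-1\}$, including the empty string $\epsilon$. The length of a string $X$ is $|X|$. For a string $X$, $n(X)$ is the non-negative integer it represents in base $b$ (left-to-right positional notation), with $n(\epsilon)=0$, and $x(X)=n(X)/b^{|X|}\in[0,1)$. $k_w(X)$ is the number of occurrences of $w$ in $X$, counting possibly overlapping occurrences: indices $i$ with $x_i\dots x_{i+p-1}=w$. $\delta_y$ denotes the Dirac mass at $y$. *)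

(* Defs.v *)
From HB Require Import structures.
From mathcomp Require Import all_boot all_order all_algebra.
From mathcomp Require Import all_classical all_reals.
From mathcomp Require Import ereal topology normedtype sequences.
Set Implicit Arguments. Unset Strict Implicit. Unset Printing Implicit Defensive.
Import Order.TTheory GRing.Theory Num.Theory.

Definition nval (b : nat) (X : seq 'I_b) : nat :=
  foldl (fun acc (d : 'I_b) => acc * b + d) 0 X.

Definition xval (R : realType) (b : nat) (X : seq 'I_b) : R :=
  ((nval X)%:R / (b%:R ^+ size X))%R.

Definition occ (b : nat) (w X : seq 'I_b) : nat :=
  count (fun i => take (size w) (drop i X) == w) (iota 0 (size X)).

Local Open Scope ereal_scope.
Definition mu (R : realType) (b : nat) (w : seq 'I_b) (k : nat)
  (I : set R) : \bar R :=
  \sum_(0 <= n <oo)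
    \sum_(X : n.-tuple 'I_b | (occ w X == k) && (xval R X \in I))
      ((b%:R ^- n)%R)%:E.

(* Main.v *)
(** Read a string from left to right as independent uniform digits, so that
    strings of length n carry total weight 1, and let p = |w|.

    If A_n is the probability that n digits avoid w, deleting the first digit
    shows that A_n - A_(n+1) is the probability that n + 1 digits start with w
    and contain no other occurrence.  Since A_n tends to 0, these telescoping
    differences add up to A_(p-1) = 1: after an occurrence of w, the expected
    number of lengths at which no new occurrence has appeared is b^p.

    For any prefix Y and any k > k_w(Y), the k-th occurrence in Y Z almost surely
    appears, and from then on only the last p digits matter; so the strings Y Z
    with exactly k occurrences have total weight b^p b^(-|Y|).  Hence mu_k gives
    mass exactly b^p b^(-j) to each b-adic cell of length b^(-j) as soon as
    k > j, up to strings shorter than j, which have fewer than k occurrences.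
    Sandwiching an interval between unions of cells costs at most
    3 b^p b^(-j). *)

Require Import Defs.
From HB Require Import structures.
From mathcomp Require Import all_boot all_order all_algebra.
From mathcomp Require Import all_classical all_reals.
From mathcomp Require Import ereal topology normedtype sequences.
From mathcomp Require Import ring lra.
Set Implicit Arguments. Unset Strict Implicit. Unset Printing Implicit Defensive.
Import Order.TTheory GRing.Theory Num.Theory.
Import numFieldNormedType.Exports.
Local Open Scope classical_set_scope.
Local Open Scope ring_scope.

(** * Occurrences of a block in concatenated strings *)

Lemma occ_cons (b : nat) (w : seq 'I_b) d X :
  occ w (d :: X) = (prefix w (d :: X) + occ w X)%N.
Proof.
rewrite prefixE /occ /= -[1%N]addn0 iotaDl count_map.
by congr addn; apply: eq_count => i.
Qed.

Lemma occ_size (b : nat) (w X : seq 'I_b) : (occ w X <= size X)%N.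
Proof. by rewrite /occ (leq_trans (count_size _ _)) ?size_iota. Qed.

Lemma prefix_catr_long (T : eqType) (w X Z : seq T) :
  (size w <= size X)%N -> prefix w (X ++ Z) = prefix w X.
Proof. by move=> wX; rewrite !prefixE takel_cat. Qed.

Lemma prefix_short (T : eqType) (w X : seq T) :
  (size X < size w)%N -> prefix w X = false.
Proof. by move=> Xw; apply/negP => /size_prefix; rewrite leqNgt Xw. Qed.

Lemma occ_cat_ge (b : nat) (w Y Z : seq 'I_b) :
  (occ w Y + occ w Z <= occ w (Y ++ Z))%N.
Proof.
elim: Y => [//|d Y IH]; rewrite cat_cons !occ_cons -addnA leq_add //.
by case pw: (prefix w (d :: Y)); rewrite // -cat_cons prefix_catl.
Qed.

Lemma occ_short (b : nat) (w X : seq 'I_b) :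
  (size X < size w)%N -> occ w X = 0%N.
Proof.
elim: X => [//|d X IH] Xw; rewrite occ_cons IH ?(ltn_trans _ Xw)//.
by rewrite prefix_short.
Qed.

Lemma occ_self (b : nat) (w : seq 'I_b) : (0 < size w)%N -> occ w w = 1%N.
Proof.
case: w => // d w _; rewrite occ_cons prefix_refl occ_short //=.
Qed.

(** An occurrence starting inside [U] cannot reach past the [w] that follows, so the count splits at
    that middle [w], which both sides count once. *)
Lemma occ_split (b : nat) (w U Z : seq 'I_b) : (0 < size w)%N ->
  (occ w (U ++ w ++ Z)).+1 = (occ w (U ++ w) + occ w (w ++ Z))%N.
Proof.
move=> w0; elim: U => [|d U IH]; first by rewrite /= occ_self.
rewrite !cat_cons !occ_cons -addnS IH addnA; congr (_ + _ + _)%N.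
rewrite catA -cat_cons prefix_catr_long //= size_cat.
by rewrite leqW // leq_addl.
Qed.

(** Only an occurrence ending at the appended digit can be new, and there is at most one such. *)
Lemma occ_rcons (b : nat) (w Y : seq 'I_b) d : (0 < size w)%N ->
  occ w (rcons Y d) = occ w Y \/
  occ w (rcons Y d) = (occ w Y).+1 /\ exists U, rcons Y d = U ++ w.
Proof.
move=> w0; elim: Y => [|x Y IH].
  rewrite /= occ_cons; case: (boolP (prefix w [:: d])) => [pw|]; last by left.
  right; split=> //; exists [::]; case: w w0 pw => //= e [|f w] //= _.
    by rewrite andbT => /eqP ->.
  by rewrite andbF.
rewrite rcons_cons !occ_cons.
have [wY|Yw] := leqP (size w) (size (x :: Y)).
  rewrite -rcons_cons -cats1 prefix_catr_long //.
  case: IH => [->|[-> [U YU]]]; first by left.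
  by right; split; [rewrite addnS|exists (x :: U); rewrite cats1 rcons_cons YU].
have -> : occ w (rcons Y d) = 0%N by rewrite occ_short // size_rcons.
have -> : occ w Y = 0%N by rewrite occ_short // (ltn_trans _ Yw).
have -> : prefix w (x :: Y) = false.
  by rewrite prefix_short.
case: (boolP (prefix w _)) => [pw|]; last by left.
right; split=> //; exists [::] => /=; move: pw; rewrite prefixE => /eqP <-.
by rewrite take_oversize //= size_rcons.
Qed.

(** * Averages over strings of uniform digits *)

Section Avg.
Context {R : realType} {b : nat}.
Implicit Types (g h : seq 'I_b -> R).

(** Expectation over [n] independent uniform digits. Recursion on the first digit makes conditioning
    on it computational; [avg_tuple] recovers the weighted sum over tuples used in [mu]. *)
Fixpoint avg (n : nat) g : R :=
  if n is m.+1 then b%:R^-1 * \sum_(d < b) avg m (fun Z => g (d :: Z))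
  else g [::].

Lemma avg_ext n g h : (forall Z, size Z = n -> g Z = h Z) -> avg n g = avg n h.
Proof.
elim: n g h => [|n IH] g h gh /=; first exact: gh.
by congr (_ * _); apply: eq_bigr => d _; apply: IH => Z Zn; apply: gh; rewrite /= Zn.
Qed.

Lemma avg_le n g h : (forall Z, size Z = n -> g Z <= h Z) -> avg n g <= avg n h.
Proof.
elim: n g h => [|n IH] g h gh /=; first exact: gh.
rewrite ler_wpM2l ?invr_ge0//; apply: ler_sum => d _; apply: IH => Z Zn.
by apply: gh; rewrite /= Zn.
Qed.

Lemma avgD n g h : avg n (fun Z => g Z + h Z) = avg n g + avg n h.
Proof.
elim: n g h => [//|n IH] g h /=; rewrite -mulrDr -big_split /=.
by congr (_ * _); apply: eq_bigr => d _; rewrite IH.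
Qed.

Lemma avgZ n r g : avg n (fun Z => r * g Z) = r * avg n g.
Proof.
elim: n g => [//|n IH] g /=; rewrite [RHS]mulrCA [in RHS]mulr_sumr.
by congr (_ * _); apply: eq_bigr => d _; rewrite IH.
Qed.

Lemma avgB n g h : avg n (fun Z => g Z - h Z) = avg n g - avg n h.
Proof.
rewrite -[- avg n h]mulN1r -avgZ -avgD; apply: avg_ext => Z _.
by rewrite mulN1r.
Qed.

Lemma avg_sum n (N : nat) (G : nat -> seq 'I_b -> R) :
  avg n (fun Z => \sum_(0 <= i < N) G i Z) = \sum_(0 <= i < N) avg n (G i).
Proof.
elim: N => [|N IH].
  rewrite big_nil (@avg_ext _ _ (fun=> 0 * 0)) ?avgZ ?mul0r// => Z _.
  by rewrite big_nil ?mul0r.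
rewrite big_nat_recr //= -IH -avgD; apply: avg_ext => Z _.
by rewrite big_nat_recr.
Qed.

Lemma sum_avg_recl (N : nat) g :
  \sum_(0 <= n < N.+1) avg n g =
  g [::] + b%:R^-1 * \sum_(d < b) \sum_(0 <= n < N) avg n (fun Z => g (d :: Z)).
Proof.
rewrite big_nat_recl //=; congr (_ + _).
by rewrite exchange_big /= mulr_sumr.
Qed.

Lemma avg_cat m n g :
  avg (m + n) g = avg m (fun Y => avg n (fun Z => g (Y ++ Z))).
Proof.
elim: m g => [//|m IH] g /=.
by congr (_ * _); apply: eq_bigr => d _; rewrite IH.
Qed.

Hypothesis b_gt0 : (0 < b)%N.

Lemma avg_cst n r : avg n (fun=> r) = r.
Proof.
elim: n => //= n ->; rewrite sumr_const card_ord -[r *+ b]mulr_natl mulKf //.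
by rewrite pnatr_eq0 -lt0n.
Qed.

Lemma avg_drop m n g : avg (m + n) (fun X => g (drop m X)) = avg n g.
Proof.
rewrite avg_cat -[RHS](avg_cst m); apply: avg_ext => Y <-.
by apply: avg_ext => Z _; rewrite drop_size_cat.
Qed.

Lemma avg_ge0 n g : (forall Z, size Z = n -> 0 <= g Z) -> 0 <= avg n g.
Proof. by move=> g0; rewrite -[0](avg_cst n) avg_le. Qed.

Lemma avg_cvg n (G : nat -> seq 'I_b -> R) g :
  (forall Z, size Z = n -> G ^~ Z @ \oo --> g Z) ->
  (fun N => avg n (G N)) @ \oo --> avg n g.
Proof.
elim: n G g => [|n IH] G g Gg /=; first exact: Gg.
apply: cvgMl_tmp; apply: cvg_big => [|d _]; first exact: add_continuous.
apply: (IH (fun N Z => G N (d :: Z))).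
by move=> Z Zn; apply: Gg; rewrite /= Zn.
Qed.

Lemma avg_eq_prefix w n g :
  avg (size w + n) (fun X => (prefix w X)%:R * g X) =
  b%:R ^- size w * avg n (fun Z => g (w ++ Z)).
Proof.
elim: w g => [|d w IH] g /=.
  by rewrite expr0 invr1 mul1r; apply: avg_ext => Z _; rewrite prefix0s mul1r.
rewrite (bigD1 d) //= big1 ?addr0 => [|e ed]; last first.
  rewrite (@avg_ext _ _ (fun=> 0)) ?avg_cst// => Z _.
  by rewrite eq_sym (negbTE ed) mul0r.
rewrite exprS invfM -mulrA -(IH (fun X => g (d :: X))); congr (_ * _).
by apply: avg_ext => Z _; rewrite eqxx.
Qed.

Lemma avg_tuple n g :
  avg n g = \sum_(X : n.-tuple 'I_b) b%:R ^- n * g X.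
Proof.
elim: n g => [|n IH] g /=.
  rewrite (big_pred1 [tuple]) ?expr0 ?invr1 ?mul1r// => X.
  by apply/esym/eqP; exact: tuple0.
rewrite (reindex (fun p : 'I_b * n.-tuple 'I_b => cons_tuple p.1 p.2)) /=; last first.
  exists (fun X : n.+1.-tuple 'I_b => (thead X, behead_tuple X)).
    by case=> d X _ /=; congr pair; apply: val_inj.
  by move=> X _; apply: val_inj; rewrite /= [in RHS](tuple_eta X).
rewrite -(pair_bigA _ (fun d (X : n.-tuple 'I_b) => b%:R ^- n.+1 * g (d :: X))) /=.
rewrite mulr_sumr; apply: eq_bigr => d _; rewrite IH mulr_sumr.
by apply: eq_bigr => X _; rewrite exprS invfM mulrA.
Qed.

End Avg.

Lemma ler_bool (R : realType) (p q : bool) : (p -> q) -> p%:R <= q%:R :> R.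
Proof. by case: p; case: q => // ->. Qed.

(** * Expected number of lengths with a given occurrence count *)

Section Renewal.
Context {R : realType} {b : nat} (w : seq 'I_b).
Hypotheses (b_gt0 : (0 < b)%N) (w_gt0 : (0 < size w)%N).
Local Notation avg := (@avg R b).
Local Notation bp := (b%:R ^+ size w : R).

Lemma bp_gt0 : 0 < bp.
Proof. by rewrite exprn_gt0 // ltr0n. Qed.

(** With probability [b ^- p] the first [p] digits spell [w] and use up one
    occurrence; summing over [n] bounds the expected time spent below [k.+1]. *)
Lemma avg_occ_lt_block k n :
  avg (size w + n) (fun X => (occ w X < k.+1)%:R) <=
  avg n (fun Z => (occ w Z < k.+1)%:R) -
  bp^-1 * (avg n (fun Z => (occ w Z < k.+1)%:R) - avg n (fun Z => (occ w Z < k)%:R)).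
Proof.
set p := size w.
pose g Z : R := (occ w Z < k.+1)%:R - (occ w Z < k)%:R.
have -> : avg n (fun Z => (occ w Z < k.+1)%:R) - avg n (fun Z => (occ w Z < k)%:R) =
    avg n (fun Z => g (drop p (w ++ Z))).
  by rewrite -avgB; apply: avg_ext => Z _; rewrite drop_size_cat.
rewrite -(avg_eq_prefix b_gt0 w n (fun X => g (drop p X))).
rewrite -(avg_drop b_gt0 p n (fun Z => (occ w Z < k.+1)%:R)) -avgB.
apply: avg_le => X _; rewrite /g.
have oX := occ_cat_ge w (take p X) (drop p X); rewrite cat_take_drop in oX.
have pX : prefix w X -> (0 < occ w (take p X))%N.
  by rewrite prefixE => /eqP ->; rewrite occ_self.
case: (boolP (prefix w X)) => [/pX {}pX|_]; last first.
  rewrite mul0r subr0; apply: ler_bool => h.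
  by apply: leq_trans h; rewrite ltnS (leq_trans _ oX) ?leq_addl.
rewrite mul1r opprB addrC subrK; apply: ler_bool => h.
rewrite -ltnS (leq_trans _ h) // ltnS (leq_trans _ oX) //.
by rewrite -[X in (X <= _)%N]add1n leq_add2r.
Qed.

(** Each further occurrence takes at most [size w * bp] expected lengths, by summing the block
    inequality over [n]. This boundedness is what makes the later limits exist. *)
Lemma sum_avg_occ_lt k N :
  \sum_(0 <= n < N) avg n (fun Z => (occ w Z < k)%:R) <= (k * size w)%:R * bp.
Proof.
elim: k => [|k IH].
  rewrite mul0n mul0r big1 // => n _.
  by rewrite (@avg_ext _ _ _ _ (fun=> 0)) ?avg_cst.
set v := \sum_(0 <= n < N) _ in IH; set u := \sum_(0 <= n < N) _.
(* The first [size w] lengths contribute at most 1 each; the others are controlled by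
   [avg_occ_lt_block]. *)
have uN : u <= (size w)%:R + (u - bp^-1 * (u - v)).
  have uwN : u <= \sum_(0 <= n < size w + N) avg n (fun Z => (occ w Z < k.+1)%:R).
    rewrite addnC [leRHS](big_cat_nat _ (n := N)) ?leq_addr //= lerDl.
    by apply: sumr_ge0 => n _; apply: avg_ge0.
  apply: le_trans uwN _; rewrite (big_cat_nat _ (n := size w)) ?leq_addr //=.
  rewrite lerD //.
    rewrite -[leRHS]mulr1n.
    apply: le_trans (_ : \sum_(0 <= i < size w) 1 <= _); last first.
      by rewrite sumr_const_nat subn0.
    apply: ler_sum => n _; rewrite -[leRHS](avg_cst b_gt0 n) avg_le // => Z _.
    by rewrite lern1 leq_b1.
  rewrite -[X in \sum_(X <= _ < _) _]add0n big_addn addKn /u /v -sumrB mulr_sumr -sumrB.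
  by apply: ler_sum => n _; rewrite addnC avg_occ_lt_block.
rewrite mulSn natrD mulrDl; move: bp_gt0 uN IH; move: (u) (v) bp => {}u {}v B.
move=> B0 uN; have : u - v <= (size w)%:R * B; last by lra.
by rewrite -ler_pdivrMr // mulrC; move: uN; move: (B^-1 * _) => y; lra.
Qed.

(** The truncated Green function of the occurrence count, started from the prefix [Y]. *)
Definition visits Y k N : R :=
  \sum_(0 <= n < N) avg n (fun Z => (occ w (Y ++ Z) == k)%:R).

Lemma visits_ge0 Y k N : 0 <= visits Y k N.
Proof. by apply: sumr_ge0 => n _; apply: avg_ge0. Qed.

Lemma visits_le Y k N : visits Y k N <= (k.+1 * size w)%:R * bp.
Proof.
apply: le_trans (sum_avg_occ_lt k.+1 N).
apply: ler_sum => n _; apply: avg_le => Z _; apply: ler_bool => /eqP <-; rewrite ltnS.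
by rewrite (leq_trans _ (occ_cat_ge _ _ _)) ?leq_addl.
Qed.

Lemma is_cvg_visits Y k : cvgn (visits Y k).
Proof.
apply: nondecreasing_is_cvgn.
  apply/nondecreasing_seqP => N; rewrite /visits big_nat_recr //= lerDl.
  by apply: avg_ge0.
by exists ((k.+1 * size w)%:R * bp) => _ [N _ <-]; apply: visits_le.
Qed.

(** These are the terms of the convergent series [visits [::] 0]. *)
Lemma avoid_cvg0 : (fun n => avg n (fun Z => (occ w Z == 0%N)%:R)) @ \oo --> 0.
Proof. by apply: cvg_series_cvg_0; exact: (@is_cvg_visits [::] 0). Qed.

(** Strings that avoid [w] once their first digit is deleted either avoid [w] or have it as a prefix
    and nowhere else. That prefix has probability [bp^-1], hence the factor. *)
Lemma avg_occ_self m : avg m (fun Z => (occ w (w ++ Z) == 1%N)%:R) =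
  bp * (avg ((size w).-1 + m) (fun Z => (occ w Z == 0%N)%:R) -
        avg (size w + m) (fun Z => (occ w Z == 0%N)%:R)).
Proof.
pose g X : R := (occ w (drop 1 X) == 0%N)%:R.
have -> : avg m (fun Z => (occ w (w ++ Z) == 1%N)%:R) = avg m (fun Z => g (w ++ Z)).
  apply: avg_ext => Z _; rewrite /g; case: (w) w_gt0 => //= d w' _.
  by rewrite occ_cons -cat_cons prefix_prefix drop0.
have <- := avg_drop b_gt0 1 ((size w).-1 + m) (fun Z => (occ w Z == 0%N)%:R).
rewrite addnA add1n prednK // -avgB.
rewrite [in RHS](@avg_ext _ _ _ _ (fun X => (prefix w X)%:R * g X)).
  by rewrite avg_eq_prefix // mulrA divff ?mul1r // gt_eqF ?bp_gt0.
case=> [|d X]; first by move: w_gt0; case: (size w).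
have dX : drop 1 (d :: X) = X by exact: drop0.
rewrite /g dX occ_cons => _.
by case: (prefix w _); case: (occ w X) => [|?] /=; ring.
Qed.

Lemma visits_self_cvg : visits w 1 @ \oo --> bp.
Proof.
pose A n := avg n (fun Z => (occ w Z == 0%N)%:R).
have -> : visits w 1 = fun N => bp * (1 - A (N + (size w).-1)%N).
  apply/funext => N; rewrite /visits (eq_bigr _ (fun m _ => avg_occ_self m)).
  rewrite -mulr_sumr; congr (_ * _).
  (* Strings of length [(size w).-1] are too short to contain [w], so the telescoping sum starts
     from 1. *)
  have A1 : A (size w).-1 = 1.
    rewrite -[RHS](avg_cst b_gt0 (size w).-1); apply: avg_ext => Z Zw.
    by rewrite occ_short // Zw prednK.
  elim: N => [|N IH]; first by rewrite big_nil add0n A1 subrr.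
  have -> : (N.+1 + (size w).-1 = size w + N)%N by rewrite addSnnS prednK // addnC.
  by rewrite big_nat_recr //= IH /A [(N + _)%N]addnC addrA subrK.
have : (fun N => bp * (1 - A (N + (size w).-1)%N)) @ \oo --> bp * (1 - 0).
  apply: cvgMl_tmp; apply: cvgB; first exact: cvg_cst.
  by rewrite (cvg_shiftn (size w).-1 A); exact: avoid_cvg0.
by rewrite subr0 mulr1.
Qed.

Lemma visits_rec Y k N : visits Y k N.+1 =
  (occ w Y == k)%:R + b%:R^-1 * \sum_(d < b) visits (rcons Y d) k N.
Proof.
rewrite /visits sum_avg_recl cats0; congr (_ + _ * _).
apply: eq_bigr => d _; apply: eq_bigr => n _.
by apply: avg_ext => Z _; rewrite cat_rcons.
Qed.

(** Since [Y] has fewer than [k] occurrences, the length-zero term vanishes and the limit is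
    harmonic in the next digit. *)
Lemma lim_visits_rec Y k : (occ w Y < k)%N ->
  limn (visits Y k) = b%:R^-1 * \sum_(d < b) limn (visits (rcons Y d) k).
Proof.
move=> Yk; apply: cvg_lim => //; rewrite -cvg_shiftS /=.
have -> : (fun n => visits Y k n.+1) =
    fun n => b%:R^-1 * \sum_(d < b) visits (rcons Y d) k n.
  by apply/funext => n; rewrite visits_rec ltn_eqF // add0r.
apply: cvgMl_tmp; apply: cvg_big => [|d _]; first exact: add_continuous.
exact: is_cvg_visits.
Qed.

(** By [occ_split], what precedes the final [w] does not affect new occurrences; the case reduces to
    [visits w 1]. *)
Lemma lim_visits_suffix U : limn (visits (U ++ w) (occ w (U ++ w))) = bp.
Proof.
rewrite -(cvg_lim _ visits_self_cvg) //; congr (limn _).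
apply/funext => N; apply: eq_bigr => n _; apply: avg_ext => Z _; congr (_%:R).
congr nat_of_bool; rewrite -catA -eqSS occ_split // -addn1 eqn_add2l.
by [].
Qed.

(** The deviation from [bp] averages over the next digit and, by induction on
    [k - occ w Y], vanishes once a new occurrence appears; so it is at most a
    constant times the probability that [n] more digits avoid [w]. *)
Lemma lim_visits Y k : (occ w Y < k)%N -> limn (visits Y k) = bp.
Proof.
move=> Yk; move: (k - occ w Y)%N (subnK (ltnW Yk)) => r; elim: r Y Yk => [|r IH] Y Yk.
  by move=> h; move: Yk; rewrite -h ltnn.
(* [C] adds the uniform bound of [visits_le] to [bp]: a crude bound on the deviation, used when no
   further digit is read. *)
move=> rk; set C := (k.+1 * size w)%:R * bp + bp.
suff H n X : occ w X = occ w Y ->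
    `|limn (visits X k) - bp| <=
    C * avg n (fun Z => (occ w (X ++ Z) == occ w Y)%:R).
  apply/eqP; rewrite -subr_eq0 -normr_le0.
  have : (fun n => C * avg n (fun Z => (occ w Z == 0%N)%:R)) @ \oo --> C * 0.
    exact: cvgMl_tmp avoid_cvg0.
  rewrite mulr0 => /cvgr_to_ge; apply; near=> n.
  apply: le_trans (H n Y erefl) _; rewrite ler_wpM2l //.
    by rewrite /C addr_ge0 ?mulr_ge0 // ltW // bp_gt0.
  apply: avg_le => Z _; apply: ler_bool => /eqP h.
  by have := occ_cat_ge w Y Z; rewrite h -{2}[occ w Y]addn0 leq_add2l leqn0.
elim: n X => [|n IHn] X XY /=.
  rewrite cats0 XY eqxx mulr1 /C ler_norml.
  have lge0 : 0 <= limn (visits X k).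
    apply: limr_ge; first exact: is_cvg_visits.
    by near=> N; exact: visits_ge0.
  have lle : limn (visits X k) <= (k.+1 * size w)%:R * bp.
    apply: limr_le; first exact: is_cvg_visits.
    by near=> N; exact: visits_le.
  have := bp_gt0; lra.
have -> : limn (visits X k) - bp =
    b%:R^-1 * \sum_(d < b) (limn (visits (rcons X d) k) - bp).
  rewrite lim_visits_rec ?XY // sumrB mulrBr; congr (_ - _).
  exact: esym (avg_cst b_gt0 1 bp).
rewrite normrM ger0_norm ?invr_ge0 // mulrCA ler_wpM2l ?invr_ge0 //.
rewrite mulr_sumr; apply: le_trans (ler_norm_sum _ _ _) _.
apply: ler_sum => d _.
have -> : avg n (fun Z => (occ w (X ++ d :: Z) == occ w Y)%:R) =
    avg n (fun Z => (occ w (rcons X d ++ Z) == occ w Y)%:R).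
  by apply: avg_ext => Z _; rewrite cat_rcons.
case: (occ_rcons X d w_gt0) => [e|[e [U XU]]]; first by apply: IHn; rewrite e.
suff -> : limn (visits (rcons X d) k) = bp.
  rewrite subrr normr0 mulr_ge0 // ?avg_ge0 //.
  by rewrite /C addr_ge0 ?mulr_ge0 // ltW // bp_gt0.
(* If the new occurrence is the [k]-th, the string ends in [w] and the suffix case applies;
   otherwise one fewer is missing and [IH] applies. *)
move: Yk; rewrite leq_eqVlt => /predU1P[Yk|Yk].
  have -> : k = occ w (rcons X d) by rewrite e XY.
  by rewrite XU lim_visits_suffix.
by apply: IH; rewrite e XY // addnS -addSn.
Unshelve. all: by end_near. Qed.

End Renewal.

(** * String values and counting of [b]-adic cells *)

Lemma nval_cat (b : nat) (Y Z : seq 'I_b) :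
  nval (Y ++ Z) = (nval Y * b ^ size Z + nval Z)%N.
Proof.
rewrite /nval foldl_cat; move: (foldl _ 0%N Y) => m.
elim: Z m => [|d Z IH] m /=; first by rewrite muln1 addn0.
by rewrite IH [in RHS]IH mul0n add0n mulnDl -mulnA -expnS addnA.
Qed.

Lemma nval_lt (b : nat) (X : seq 'I_b) : (nval X < b ^ size X)%N.
Proof.
elim: X => [//|d X IH]; rewrite -cat1s nval_cat /= /nval /= mul0n add0n.
rewrite -/(nval X) expnS; apply: leq_trans (_ : d.+1 * b ^ size X <= _)%N.
  by rewrite mulSn addnC ltn_add2r.
by rewrite leq_mul2r ltn_ord orbT.
Qed.

Section Xval.
Context {R : realType} {b : nat}.
Hypothesis b_gt0 : (0 < b)%N.
Let expb_gt0 n : 0 < b%:R ^+ n :> R.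
Proof. by rewrite exprn_gt0 // ltr0n. Qed.

Lemma xval_ge0 (X : seq 'I_b) : 0 <= xval R X.
Proof. by rewrite divr_ge0 // ltW. Qed.

Lemma xval_lt1 (X : seq 'I_b) : xval R X < 1.
Proof. by rewrite ltr_pdivrMr // mul1r -natrX ltr_nat nval_lt. Qed.

Lemma xval_cat (Y Z : seq 'I_b) :
  xval R (Y ++ Z) = xval R Y + xval R Z / b%:R ^+ size Y.
Proof.
rewrite /xval nval_cat size_cat natrD natrM natrX exprD.
by field; rewrite !gt_eqF.
Qed.

(** Uniform digits give a uniform integer below [b ^ n]: the leading digit selects one of [b]
    consecutive blocks of integers. *)
Lemma avg_nval n (h : nat -> R) :
  avg n (fun Y : seq 'I_b => h (nval Y)) = b%:R ^- n * \sum_(0 <= v < b ^ n) h v.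
Proof.
elim: n h => [|n IH] h /=; first by rewrite big_nat1 expr0 invr1 mul1r.
rewrite exprS invfM -mulrA expnS big_nat_mul big_mkord; congr (_ * _).
rewrite mulr_sumr.
apply: eq_bigr => d _.
rewrite -[X in \sum_(X <= _ < _) _]add0n big_addn mulSn addnK.
rewrite -(IH (fun v => h (v + d * b ^ n)%N)); apply: avg_ext => Z <-.
by rewrite -cat1s nval_cat addnC.
Qed.

Lemma sum_lt_ge (B : nat) (s : R) :
  Num.min s B%:R <= \sum_(0 <= v < B) (v%:R < s)%R%:R.
Proof.
elim: B => [|B IH]; first by rewrite big_nil ge_min lexx orbT.
rewrite big_nat_recr //= ge_min; move: IH; rewrite ge_min.
rewrite -natr1; case: (ltP B%:R s) => /= Bs /orP[IH|IH]; apply/orP.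
- by right; lra.
- by right; lra.
- by left; lra.
- by left; lra.
Qed.

Lemma sum_lt_le (B : nat) (s : R) : -1 <= s ->
  \sum_(0 <= v < B) (v%:R < s)%R%:R <= s + 1.
Proof.
(* The trivial bound [B] is carried along because, when [B < s], the new term 1 is absorbed by
   [B + 1 < s + 1]. *)
move=> s1; suff : \sum_(0 <= v < B) (v%:R < s)%R%:R <= Num.min (s + 1) B%:R.
  by rewrite le_min => /andP[].
elim: B => [|B IH]; first by rewrite big_nil le_min lexx andbT; lra.
rewrite big_nat_recr //= le_min; move: IH; rewrite le_min => /andP[IH1 IH2].
by rewrite -natr1; case: (ltP B%:R s) => /= Bs; apply/andP; split; lra.
Qed.

Lemma avg_xval_lt n (s : R) :
  avg n (fun Y : seq 'I_b => (xval R Y < s)%R%:R) =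
  b%:R ^- n * \sum_(0 <= v < b ^ n) (v%:R < s * b%:R ^+ n)%R%:R :> R.
Proof.
rewrite -(avg_nval n (fun v => (v%:R < s * b%:R ^+ n)%R%:R : R)).
by apply: avg_ext => Y <-; rewrite ltr_pdivrMr.
Qed.

Lemma avg_xval_lt_ge n (s : R) : s <= 1 ->
  s <= avg n (fun Y : seq 'I_b => (xval R Y < s)%R%:R).
Proof.
move=> s1; rewrite avg_xval_lt mulrC ler_pdivlMr //.
apply: le_trans (sum_lt_ge _ _); rewrite le_min lexx /=.
by rewrite natrX ler_piMl // ltW.
Qed.

Lemma avg_xval_lt_le n (s : R) : - b%:R ^- n <= s ->
  avg n (fun Y : seq 'I_b => (xval R Y < s)%R%:R) <= s + b%:R ^- n.
Proof.
move=> s1; rewrite avg_xval_lt mulrC ler_pdivrMr //.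
rewrite mulrDl mulVf ?gt_eqF //; apply: sum_lt_le.
by rewrite -ler_pdivrMr // mulN1r.
Qed.

End Xval.

(** * Mass of an interval and its limit *)

Section Mass.
Context {R : realType} {b : nat} (w : seq 'I_b).
Hypotheses (b_gt0 : (0 < b)%N) (w_gt0 : (0 < size w)%N).
Local Notation bp := (b%:R ^+ size w : R).
Implicit Types (A : set R).

Definition mass A k N : R :=
  \sum_(0 <= n < N) avg n (fun X => ((occ w X == k) && (xval R X \in A))%:R).

Lemma is_cvg_mass A k : cvgn (mass A k).
Proof.
apply: nondecreasing_is_cvgn.
  apply/nondecreasing_seqP => N; rewrite /mass big_nat_recr //= lerDl.
  by apply: avg_ge0.
exists ((k.+1 * size w)%:R * bp) => _ [N _ <-].
apply: le_trans (visits_le b_gt0 w_gt0 [::] k N).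
apply: ler_sum => n _; apply: avg_le => Z _.
by apply: ler_bool => /andP[].
Qed.

Lemma mu_lim_mass A k : mu w k A = (limn (mass A k))%:E.
Proof.
rewrite /mu -EFin_lim; last exact: is_cvg_mass.
congr (limn _); apply/funext => N /=; rewrite -sumEFin.
apply: eq_bigr => n _; rewrite avg_tuple sumEFin; congr _%:E.
rewrite big_mkcond /=; apply: eq_bigr => X _.
by case: ifP; rewrite ?mulr1 ?mulr0.
Qed.

(** Strings shorter than [j] have fewer than [k] occurrences and drop out; the others are cut after
    [j] digits. *)
Lemma mass_addl A j k N : (j < k)%N -> mass A k (j + N) =
  avg j (fun Y => \sum_(0 <= n < N)
    avg n (fun Z => ((occ w (Y ++ Z) == k) && (xval R (Y ++ Z) \in A))%:R)).
Proof.
move=> jk; rewrite /mass (big_cat_nat _ (n := j)) ?leq_addr //=.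
rewrite big_nat_cond big1 ?add0r => [|n /andP[/andP[_ nj] _]].
  rewrite -[X in \sum_(X <= _ < _) _]add0n big_addn addKn avg_sum.
  by apply: eq_bigr => n _; rewrite addnC avg_cat.
rewrite (@avg_ext _ _ _ _ (fun=> 0)) ?avg_cst // => X Xn.
rewrite ltn_eqF // (leq_ltn_trans (occ_size _ _)) // Xn.
exact: ltn_trans jk.
Qed.

Lemma avg_visits_cvg j k (g : seq 'I_b -> R) : (j < k)%N ->
  (fun N => avg j (fun Y => g Y * visits w Y k N)) @ \oo --> bp * avg j g.
Proof.
move=> jk; rewrite -avgZ; apply: avg_cvg => Y Yj.
rewrite mulrC; apply: cvgMl_tmp.
rewrite -(lim_visits b_gt0 w_gt0 (Y := Y) (k := k)); first exact: is_cvg_visits.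
by rewrite (leq_ltn_trans (occ_size _ _)) // Yj.
Qed.

Lemma mass_shift_cvg A j k : (fun N => mass A k (j + N)) @ \oo --> limn (mass A k).
Proof.
have -> : (fun N => mass A k (j + N)%N) = [sequence mass A k (N + j)%N]_N.
  by apply/funext => N; rewrite addnC.
by rewrite (cvg_shiftn j (mass A k)); exact: is_cvg_mass.
Qed.

(** A majorant depending only on the first [j] digits factors out of the sum over extensions, whose
    limit is [bp] for every prefix of length [j < k]. *)
Lemma lim_mass_le A j k (g : seq 'I_b -> R) : (j < k)%N ->
  (forall Y Z, size Y = j -> (xval R (Y ++ Z) \in A)%:R <= g Y) ->
  limn (mass A k) <= bp * avg j g.
Proof.
move=> jk Ag.
have := ler_cvg_to (@mass_shift_cvg A j k) (@avg_visits_cvg j k g jk); apply.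
near=> N; rewrite mass_addl //; apply: avg_le => Y Yj.
rewrite mulr_sumr; apply: ler_sum => n _; rewrite -avgZ; apply: avg_le => Z _.
have := Ag Y Z Yj; case: (_ == k); last by rewrite mulr0.
by rewrite mulr1.
Unshelve. all: by end_near. Qed.

Lemma lim_mass_ge A j k (g : seq 'I_b -> R) : (j < k)%N ->
  (forall Y Z, size Y = j -> g Y <= (xval R (Y ++ Z) \in A)%:R) ->
  bp * avg j g <= limn (mass A k).
Proof.
move=> jk Ag.
have := ler_cvg_to (@avg_visits_cvg j k g jk) (@mass_shift_cvg A j k); apply.
near=> N; rewrite mass_addl //; apply: avg_le => Y Yj.
rewrite mulr_sumr; apply: ler_sum => n _; rewrite -avgZ; apply: avg_le => Z _.
by have := Ag Y Z Yj; case: (_ == k); rewrite ?mulr1 ?mulr0.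
Unshelve. all: by end_near. Qed.

(** Placing [A] between the open and the closed interval treats all four kinds of endpoints at
    once. *)
Lemma lim_mass_dist A (a c : R) j k : 0 <= a -> a <= c -> c <= 1 ->
  (forall x, x \in A -> a <= x <= c) -> (forall x, a < x < c -> x \in A) ->
  (j < k)%N -> `|bp * (c - a) - limn (mass A k)| <= bp * (3 * b%:R ^- j).
Proof.
move=> a0 ac c1 Aac acA jk; have bp0 : 0 < bp := bp_gt0 w b_gt0.
set h := b%:R ^- j.
have h0 : 0 < h by rewrite invr_gt0 exprn_gt0 // ltr0n.
pose G s := avg j (fun Y : seq 'I_b => (xval R Y < s)%R%:R) : R.
have cell (Y Z : seq 'I_b) : size Y = j -> xval R Y <= xval R (Y ++ Z) < xval R Y + h.
  move=> Yj; rewrite xval_cat // Yj -/h lerDl ltrD2l mulr_ge0 ?xval_ge0 ?ltW //=.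
  by rewrite gtr_pMl // xval_lt1.
(* A cell meeting [A] has its left end in [[a - h, c + h)]; below, a cell with left end in
   [[a + h, c - h)] lies inside [A]. *)
have Gle : limn (mass A k) <= bp * (G (c + h) - G (a - h)).
  rewrite -avgB; apply: lim_mass_le => // Y Z Yj; have /andP[YZ ZY] := cell Y Z Yj.
  case: (boolP (xval R (Y ++ Z) \in A)) => [/Aac/andP[aZ Zc]|_].
    have -> : xval R Y < c + h by lra.
    by rewrite (_ : xval R Y < a - h = false) ?subr0 //; apply/negbTE; lra.
  by rewrite subr_ge0; apply: ler_bool; lra.
have Gge : bp * (G (c - h) - G (a + h)) <= limn (mass A k).
  rewrite -avgB; apply: lim_mass_ge => // Y Z Yj; have /andP[YZ ZY] := cell Y Z Yj.
  rewrite lerBlDr; case: (ltP (xval R Y) (c - h)) => Yc; last by rewrite addr_ge0.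
  case: (ltP (xval R Y) (a + h)) => aY; first by rewrite lerDr.
  by rewrite acA ?addr0 //; lra.
have G1 : G (c + h) <= c + h + h by apply: avg_xval_lt_le => //; rewrite -/h; lra.
have G2 : a - h <= G (a - h) by apply: avg_xval_lt_ge => //; lra.
have G3 : G (a + h) <= a + h + h by apply: avg_xval_lt_le => //; rewrite -/h; lra.
have G4 : c - h <= G (c - h) by apply: avg_xval_lt_ge => //; lra.
(* The 3 comes from shifting both endpoints by [h], plus [h] for rounding in the cell count. *)
have Gle' : bp * (G (c + h) - G (a - h)) <= bp * (c - a + 3 * h).
  by rewrite ler_pM2l //; lra.
have Gge' : bp * (c - a - 3 * h) <= bp * (G (c - h) - G (a + h)).
  by rewrite ler_pM2l //; lra.
move: (le_trans Gle Gle') (le_trans Gge' Gge).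
by rewrite mulrDr mulrBr ler_norml => ? ?; apply/andP; split; lra.
Qed.

End Mass.

Theorem theorem2 (R : realType) (b : nat) (w : seq 'I_b)
    (ba bc : bool) (a c : R) :
  (2 <= b)%N -> (1 <= size w)%N ->
  0 <= a -> a <= c -> c <= 1 ->
  [set` Interval (BSide ba a) (BSide bc c)] `<=` `[0, 1[ ->
  (fun k => mu w k [set` Interval (BSide ba a) (BSide bc c)]) @ \oo -->
    ((b%:R ^+ size w * (c - a))%:E : \bar R).
Proof.
move=> b2 w0 a0 ac c1 _; have b0 : (0 < b)%N := ltnW b2.
set A := [set` _].
have Aac x : x \in A -> a <= x <= c.
  rewrite mem_setE; case: (ba); case: (bc); rewrite in_itv /= => /andP[? ?];
    apply/andP; split; lra.
have acA x : a < x < c -> x \in A.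
  case/andP=> ? ?; rewrite mem_setE; case: (ba); case: (bc); rewrite in_itv /=;
    apply/andP; split; lra.
under eq_fun do rewrite mu_lim_mass //.
apply: cvg_EFin; first by near=> k.
apply/cvgrPdist_le => e e0.
(* The error bound depends on [j] alone, so [j] is fixed from [e] first and every [k > j] then
   works. *)
have : (fun j => b%:R ^+ size w * (3 * (b%:R^-1 : R) ^+ j)) @ \oo -->
    b%:R ^+ size w * (3 * 0 : R).
  do 2 apply: cvgMl_tmp; apply: cvg_expr.
  by rewrite ger0_norm ?invr_ge0 // invf_lt1 ?ltr1n ?ltr0n.
rewrite !mulr0 => /cvgr0_norm_le /(_ e e0) [j _ /(_ j (leqnn j)) /= je].
near=> k; apply: le_trans (le_trans (ler_norm _) je).
rewrite exprVn; apply: lim_mass_dist => //.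
by near: k; exact: nbhs_infty_gt.
Unshelve. all: by end_near. Qed.
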